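(* For all integers $n\ge0$ and $m$, the mapping $\gamma$ (applied at the columns $c=3i+2$, $0\le i<n$) is a bijection from the set of Schröder paths (respectively Delannoy paths) from $(0,0)$ to $(3n,m)$ that are smooth at each horizontal distance $3i+2$ from the origin for $0\le i<n$, to the set of vertically constrained $S_{CW}$ paths from $(0,0)$ to $(n,m)$ whose first step (if any) lies in $S_C$ and all of whose vertices have $y\ge0$ (respectively, with no height restriction).
   Context: A lattice path is a finite sequence of steps (vectors in $\mathbb{Z}^2$) starting at $(0,0)$; its vertices are the partial sums. Let $S_C=\{(1,1),(1,-1),(2,0)\}$. A Delannoy path is a lattice path with steps in $S_C$; a Schröder path is a Delannoy path all of whose vertices have $y\ge0$. A path is smooth at the integer column $x=c$ if either it contains a step $(2,0)$ from $(c-1,y)$ to $(c+1,y)$ for some $y$, or it has a vertex with $x$-coordinate $c$ and the step ending at that vertex equals the step starting at it (two consecutive equal steps $(1,1)(1,1)$, $(1,-1)(1,-1)$ or $(2,0)(2,0)$ meeting at $x=c$). The map $\gamma$ performs, at each designated column $c$, the substitution: $(1,1)(1,1)$ meeting at $c$ $\mapsto(0,2)$; $(1,-1)(1,-1)$ meeting at $c$ $\mapsto(0,-2)$; $(2,0)(2,0)$ meeting at $c$ $\mapsto(2,0)$; a single $(2,0)$ step with midpoint at $x=c$ is removed; all other steps are kept and the resulting steps concatenated in order. Let $S_{CW}=S_C\cup\{(0,2),(0,-2)\}$, with $(0,\pm2)$ vertical; a vertically constrained $S_{CW}$ path is a lattice path with steps in $S_{CW}$ with no two consecutive vertical steps.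 *)

(* Defs.v *)
From HB Require Import structures.
From mathcomp Require Export all_boot all_order all_algebra.
From mathcomp Require Export classical_sets functions.

Set Implicit Arguments.
Unset Strict Implicit.
Unset Printing Implicit Defensive.

Import Order.TTheory GRing.Theory Num.Theory.
Local Open Scope ring_scope.
Local Open Scope classical_set_scope.

Definition step : Type := (int * int)%type.
Definition lattice_path : Type := seq step.

Definition up : step := (1, 1).
Definition down : step := (1, -1).
Definition level : step := (2, 0).
Definition vup : step := (0, 2).
Definition vdown : step := (0, -2).

Definition S_C : seq step := [:: up; down; level].
Definition S_V : seq step := [:: vup; vdown].
Definition S_CW : seq step := S_C ++ S_V.

(* The vertices of p are [vertex p k] for k <= size p. *)
Definition vertex (p : lattice_path) (k : nat) : int * int := \sum_(s <- take k p) s.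

Definition endpoint (p : lattice_path) : int * int := vertex p (size p).

Definition nonneg_heights (p : lattice_path) : Prop :=
  forall k, (k <= size p)%N -> 0 <= (vertex p k).2.

Definition Delannoy (p : lattice_path) : Prop := {subset p <= S_C}.

Definition Schroder (p : lattice_path) : Prop := Delannoy p /\ nonneg_heights p.

Definition smooth_at (p : lattice_path) (c : int) : Prop :=
  (exists k, [/\ (k < size p)%N, nth 0 p k = level & (vertex p k).1 = c - 1])
  \/ (exists k, [/\ (k.+1 < size p)%N, (vertex p k.+1).1 = c
                  & nth 0 p k = nth 0 p k.+1]).

Definition columns (n : nat) : seq int := mkseq (fun i => (3 * i + 2)%N%:Z) n.

Definition merge_step (s : step) : step :=
  if s == up then vup else if s == down then vdown else s.

(* Left-to-right scan of the part p of a path that starts at abscissa x. In a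
   path with steps in S_C, the substitutions at two columns of cs that are at
   least 3 apart never involve a common step, so for such cs the order in which
   they are tried here is immaterial. *)
Fixpoint gamma_from (cs : seq int) (x : int) (p : lattice_path) : lattice_path :=
  match p with
  | [::] => [::]
  | s :: p1 =>
      if (s == level) && (x + 1 \in cs) then gamma_from cs (x + s.1) p1
      else match p1 with
           | t :: p2 =>
               if [&& s == t, s \in S_C & x + s.1 \in cs]
               then merge_step s :: gamma_from cs (x + s.1 + t.1) p2
               else s :: gamma_from cs (x + s.1) p1
           | [::] => [:: s]
           end
  end.

Definition gamma (cs : seq int) (p : lattice_path) : lattice_path := gamma_from cs 0 p.

Definition vertically_constrained (p : lattice_path) : Prop :=
  {subset p <= S_CW} /\
  (forall k, (k.+1 < size p)%N ->
     ~ (nth 0 p k \in S_V /\ nth 0 p k.+1 \in S_V)).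

Definition first_step_in_SC (p : lattice_path) : Prop :=
  (0 < size p)%N -> nth 0 p 0 \in S_C.

Definition smooth_Delannoy (n : nat) (m : int) : set lattice_path :=
  [set p | [/\ Delannoy p, endpoint p = ((3 * n)%N%:Z, m)
             & forall c, c \in columns n -> smooth_at p c]].

Definition smooth_Schroder (n : nat) (m : int) : set lattice_path :=
  [set p | [/\ Schroder p, endpoint p = ((3 * n)%N%:Z, m)
             & forall c, c \in columns n -> smooth_at p c]].

Definition CW_paths (n : nat) (m : int) : set lattice_path :=
  [set q | [/\ vertically_constrained q, endpoint q = (n%:Z, m)
             & first_step_in_SC q]].

Definition nonneg_CW_paths (n : nat) (m : int) : set lattice_path :=
  [set q | CW_paths n m q /\ nonneg_heights q].

(* Main.v *)
Require Import Defs.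
From mathcomp Require Import all_boot all_order all_algebra.
From mathcomp Require Import classical_sets functions.
From mathcomp Require Import zify.
Import Defs.

(** Smoothness at the columns [3i+2] cuts a Delannoy path ending on the line
    [x = 3n] into blocks. A block starts at some abscissa [3i] with an up step, a
    down step or two level steps meeting at [3i+2]; this brings it to an
    abscissa [3j+1], where [j] is [i] or [i+1]. It ends with one of the three
    patterns smooth at [3j+2]: a level step, two up steps or two down steps. The
    map [gamma] turns the initial part into a single step of [S_C] and the final
    part into nothing, [(0,2)] or [(0,-2)], and the vertically constrained paths
    starting with a step of [S_C] are exactly the concatenations of such images.
    Vertices of a block that disappear have heights between those of vertices
    that survive, so nonnegativity is preserved both ways. *)

Import Order.TTheory GRing.Theory Num.Theory.
Local Open Scope ring_scope.
Local Open Scope classical_set_scope.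

(** * Vertices, endpoints and smoothness, recursively along a path *)

Lemma vertex0 p : vertex p 0 = 0.
Proof. by rewrite /vertex take0 big_nil. Qed.

Lemma vertex_cons s p k : vertex (s :: p) k.+1 = s + vertex p k.
Proof. by rewrite /vertex /= big_cons. Qed.

Lemma endpoint_cons s p : endpoint (s :: p) = s + endpoint p.
Proof. exact: vertex_cons. Qed.

Lemma endpoint_nil : endpoint [::] = 0.
Proof. by rewrite /endpoint /vertex big_nil. Qed.

Lemma endpoint_cat p q : endpoint (p ++ q) = endpoint p + endpoint q.
Proof. by rewrite /endpoint /vertex !take_size big_cat. Qed.

Lemma S_C_E s : s \in S_C -> [\/ s = up, s = down | s = level].
Proof.
by rewrite !inE => /or3P[] /eqP->; [apply: Or31|apply: Or32|apply: Or33].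
Qed.

Lemma Delannoy_cons s p : Delannoy (s :: p) <-> s \in S_C /\ Delannoy p.
Proof.
split=> [H|[Hs Hp] t]; last by rewrite inE => /predU1P[->|/Hp].
by split=> [|t tp]; apply: H; rewrite inE ?eqxx ?tp ?orbT.
Qed.

Lemma vertex_x_ge0 p k : Delannoy p -> 0 <= (vertex p k).1.
Proof.
elim: p k => [|s p IH] [|k] H; rewrite ?/vertex ?big_nil // -/(vertex _ _).
rewrite vertex_cons /=; case/Delannoy_cons: H => /S_C_E Hs /IH - /(_ k).
by case: Hs => -> /=; lia.
Qed.

Lemma Delannoy_x_gt0 s p : Delannoy (s :: p) -> 0 < (endpoint (s :: p)).1.
Proof.
rewrite endpoint_cons /= => /Delannoy_cons[/S_C_E Hs /(vertex_x_ge0 _ (size p))].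
by rewrite -/(endpoint p); case: Hs => -> /=; lia.
Qed.

Lemma smooth_at_nil c : ~ smooth_at [::] c.
Proof. by case=> [[k []]|[k []]]. Qed.

(** Trades the index witnesses of [smooth_at] for a recursion on the path: after the first step,
    columns are measured from the new starting point. *)
Lemma smooth_at_cons s p c : smooth_at (s :: p) c <->
  [\/ s = level /\ c = 1, ohead p = Some s /\ s.1 = c | smooth_at p (c - s.1)].
Proof.
split.
- case=> [[[|k] /= [Hk Hn Hv]]|[[|k] [Hk Hv Hn]]].
  + by apply: Or31; split=> //; move: Hv; rewrite vertex0 /=; lia.
  + apply: Or33; left; exists k; split=> //.
    by move: Hv; rewrite vertex_cons /=; lia.
  + apply: Or32; move: Hv; rewrite vertex_cons vertex0 addr0 => ->.
    by case: p Hk Hn => //= t p _ ->.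
  + apply: Or33; right; exists k; split=> //.
    by move: Hv; rewrite vertex_cons /=; lia.
- case=> [[-> ->]|[Hs <-]|[[k [Hk Hn Hv]]|[k [Hk Hv Hn]]]].
  + by left; exists 0%N; rewrite vertex0.
  + right; exists 0%N; rewrite vertex_cons vertex0 addr0.
    by case: p Hs => //= t p [->].
  + left; exists k.+1; rewrite vertex_cons; split=> //=.
    by rewrite Hv; lia.
  + right; exists k.+1; rewrite vertex_cons; split=> //=.
    by rewrite Hv; lia.
Qed.

(** Serves to discard the recursive case of [smooth_at_cons] when the first step already reaches or
    passes the column. *)
Lemma smooth_at_gt0 p c : Delannoy p -> smooth_at p c -> 0 < c.
Proof.
elim: p c => [|s p IH] c; first by move=> _ /smooth_at_nil.
move=> /Delannoy_cons[/S_C_E Hs Dp] /smooth_at_cons[[_ ->]//|[_ <-]|/(IH _ Dp)].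
  by case: Hs => ->.
by case: Hs => -> /=; lia.
Qed.

(** * Blocks, their images, and the action of [gamma] on them *)

Definition dir (o : option bool) : step :=
  if o is Some b then if b then up else down else level.

(* The first component selects how a block starts and the second one the pattern
   met at its last designated column. *)
Definition block : Type := (option bool * option bool)%type.

Definition src (b : block) : lattice_path :=
  (if b.1 is None then [:: level; level] else [:: dir b.1]) ++
  (if b.2 is None then [:: level] else [:: dir b.2; dir b.2]).

Definition tgt (b : block) : lattice_path :=
  dir b.1 :: (if b.2 is None then [::] else [:: merge_step (dir b.2)]).

(** The number of designated columns that the block crosses, and also the horizontal extent of its
    image; the block itself is three times as wide. *)
Definition width (b : block) : nat := if b.1 is None then 2 else 1.

Definition srcs (bs : seq block) : lattice_path := flatten (map src bs).
Definition tgts (bs : seq block) : lattice_path := flatten (map tgt bs).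
Definition widths (bs : seq block) : nat := sumn (map width bs).

Lemma srcs_cons b bs : srcs (b :: bs) = src b ++ srcs bs.
Proof. by []. Qed.

Lemma tgts_cons b bs : tgts (b :: bs) = tgt b ++ tgts bs.
Proof. by []. Qed.

Lemma widths_cons b bs : widths (b :: bs) = (width b + widths bs)%N.
Proof. by []. Qed.

Lemma endpoint_src b : (endpoint (src b)).1 = (3 * width b)%N%:Z.
Proof. by case: b => [[[]|] [[]|]]; rewrite !endpoint_cons endpoint_nil. Qed.

Lemma endpoint_tgt b : endpoint (tgt b) = ((width b)%:Z, (endpoint (src b)).2).
Proof. by case: b => [[[]|] [[]|]]; rewrite !endpoint_cons endpoint_nil. Qed.

Lemma endpoint_srcs bs : (endpoint (srcs bs)).1 = (3 * widths bs)%N%:Z.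
Proof.
elim: bs => [|b bs IH]; first by rewrite endpoint_nil.
by rewrite srcs_cons widths_cons endpoint_cat /= endpoint_src IH; lia.
Qed.

Lemma endpoint_tgts bs :
  endpoint (tgts bs) = ((widths bs)%:Z, (endpoint (srcs bs)).2).
Proof.
elim: bs => [|b bs IH]; first by rewrite endpoint_nil.
by rewrite srcs_cons tgts_cons widths_cons 2!endpoint_cat endpoint_tgt IH PoszD.
Qed.

Lemma mem_columns (n : nat) (x : int) :
  x \in columns n = [exists i : 'I_n, x == (3 * i + 2)%N%:Z].
Proof.
apply/mapP/existsP => [[i]|[i /eqP->]]; last by exists (val i); rewrite ?mem_iota /=.
by rewrite mem_iota => /= lt_in ->; exists (Ordinal lt_in).
Qed.

Lemma columnE (n i : nat) : (i < n)%N -> (3 * i + 2)%N%:Z \in columns n.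
Proof. by move=> i_n; rewrite mem_columns; apply/existsP; exists (Ordinal i_n). Qed.

Lemma not_column (n i k : nat) :
  (k < 2)%N -> ((3 * i + k)%N%:Z \in columns n) = false.
Proof. by move=> k2; rewrite mem_columns; apply/existsP => -[j /eqP[]]; lia. Qed.

Lemma gamma_src n i b r : (i + width b <= n)%N ->
  gamma_from (columns n) (3 * i)%N%:Z (src b ++ r) =
  tgt b ++ gamma_from (columns n) (3 * (i + width b))%N%:Z r.
Proof.
move=> le_n.
have col x j : x = (3 * j + 2)%N%:Z -> (j < n)%N -> x \in columns n.
  by move=> -> /columnE.
(* Since [3i+1] is not designated, an opening level step is not removed, and an opening diagonal
   step is not merged with an equal step after it. *)
have C0 : (3 * i)%N%:Z + 1 \in columns n = false by rewrite -(@not_column n i 1).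
have C1 : (i < n)%N -> (3 * i)%N%:Z + 1 + 1 \in columns n by apply: col; lia.
have C2 : (i < n)%N -> (3 * i)%N%:Z + 2 \in columns n by apply: col; lia.
have C3 : (i.+1 < n)%N -> (3 * i)%N%:Z + 2 + 2 + 1 \in columns n.
  by apply: col; lia.
case: b le_n => [[[]|] [[]|]]; rewrite /width /= => le_n;
  rewrite /= ?C0 ?C1 ?C2 ?C3 ?andbF //= /merge_step /=; try lia;
  do ?congr (_ :: _); congr (gamma_from _ _ _); lia.
Qed.

Lemma gamma_srcs n bs : widths bs = n -> gamma (columns n) (srcs bs) = tgts bs.
Proof.
rewrite /gamma => Hn.
suff H i : (i + widths bs <= n)%N ->
    gamma_from (columns n) (3 * i)%N%:Z (srcs bs) = tgts bs.
  by apply: (H 0%N); rewrite Hn.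
elim: bs i {Hn} => [|b bs IH] i //; rewrite widths_cons addnA => le_n.
rewrite srcs_cons tgts_cons gamma_src ?IH //.
exact: leq_trans (leq_addr _ _) le_n.
Qed.

Lemma Delannoy_srcs bs : Delannoy (srcs bs).
Proof.
elim: bs => [//|[[[]|] [[]|]] bs IH]; rewrite /srcs /=;
  by do !(apply/Delannoy_cons; split=> //).
Qed.

Lemma smooth_at_cat p q c :
  smooth_at q (c - (endpoint p).1) -> smooth_at (p ++ q) c.
Proof.
elim: p c => [|s p IH] c; first by rewrite endpoint_nil /= subr0.
rewrite endpoint_cons /= opprD addrA => /IH H.
by apply/smooth_at_cons; apply: Or33.
Qed.

Lemma smooth_srcs bs c : c \in columns (widths bs) -> smooth_at (srcs bs) c.
Proof.
rewrite mem_columns => /existsP[[i /= lt_i] /eqP->].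
elim: bs i lt_i => [//|b bs IH] i; rewrite widths_cons srcs_cons => lt_i.
have [le_b|lt_b] := leqP (width b) i.
  apply: smooth_at_cat; rewrite endpoint_src.
  have /IH : (i - width b < widths bs)%N by lia.
  by congr smooth_at; lia.
(* The column now lies in the first block. A second column occurs only after two opening level
   steps, and it is then met by the closing pattern. *)
have {lt_b} Hi : i = 0%N \/ i = 1%N /\ b.1 = None.
  by case: b i lt_b {lt_i} => [[b1|] b2] [|[|i]] //= _; [left|left|right].
case: b Hi {lt_i} => [[b1|] b2] /= [->|[-> //]].
- apply: (@smooth_at_cat [:: dir (Some b1)]).
  rewrite endpoint_cons endpoint_nil.
  case: b2 => [[]|]; case: b1 => /=; apply/smooth_at_cons;
    by [apply: Or31 | apply: Or32].
- by apply/smooth_at_cons; apply: Or32.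
- move=> _; apply: (@smooth_at_cat [:: level; level]).
  rewrite !endpoint_cons endpoint_nil.
  case: b2 => [[]|]; apply/smooth_at_cons; by [apply: Or31 | apply: Or32].
Qed.

(** * Cutting a smooth Delannoy path into blocks *)

(* The final part of a block, which starts one unit before its last column. *)
Lemma smooth_at1_inv p : Delannoy p -> smooth_at p 1 ->
  exists (o : option bool) r,
    p = (if o is None then [:: level] else [:: dir o; dir o]) ++ r.
Proof.
case: p => [_ /smooth_at_nil //|s p Dp].
have /Delannoy_cons[/S_C_E Hs Dp'] := Dp.
case/smooth_at_cons=> [[-> _]|[Hp s1]|].
- by exists None, p.
- case: p Hp {Dp Dp'} => // t r [->]; case: Hs s1 => -> //= _.
  + by exists (Some true), r.
  + by exists (Some false), r.
- by move=> /(smooth_at_gt0 _ _ Dp'); case: Hs => -> /=; lia.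
Qed.

Lemma Delannoy_cat p q : Delannoy (p ++ q) <-> Delannoy p /\ Delannoy q.
Proof.
split=> [H|[Hp Hq] s]; last by rewrite mem_cat => /orP[/Hp|/Hq].
by split=> s sp; apply: H; rewrite mem_cat sp ?orbT.
Qed.

(** The strict inequality excludes patterns inside [p] as well as two equal steps meeting at the
    junction, so the pattern lies wholly in [q]. *)
Lemma smooth_at_cat_inv p q c : Delannoy p -> (endpoint p).1 < c ->
  smooth_at (p ++ q) c -> smooth_at q (c - (endpoint p).1).
Proof.
elim: p c => [|s p IH] c; first by rewrite endpoint_nil /= subr0.
rewrite endpoint_cons /= => /Delannoy_cons[_ Dp].
have := vertex_x_ge0 _ (size p) Dp; rewrite -/(endpoint p) => e0 lt_c.
case/smooth_at_cons=> [[Hs c1]|[_ c1]|H].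
- by move: lt_c; rewrite Hs c1 /=; lia.
- by lia.
- by rewrite opprD addrA; apply: IH => //; lia.
Qed.

(** The first step decides. After a diagonal step, column 2 is one unit ahead and [smooth_at1_inv]
    applies. After a level step, column 2 forces a second one, and column 5 is one unit ahead. *)
Lemma smooth_src_prefix n p : Delannoy p -> (endpoint p).1 = (3 * n)%N%:Z ->
  (0 < n)%N -> {in columns n, forall c, smooth_at p c} ->
  exists b r, p = src b ++ r.
Proof.
move=> Dp en n0 Hsm; have := Hsm _ (columnE _ _ n0).
case: p Dp en Hsm => [_ _ _ /smooth_at_nil //|s p] Dp en Hsm.
have /Delannoy_cons[/S_C_E Hs Dp'] := Dp.
have diag (b : bool) : s = dir (Some b) -> smooth_at (s :: p) 2 ->
    exists b r, s :: p = src b ++ r.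
  move=> -> /(@smooth_at_cat_inv [:: dir (Some b)]).
  rewrite endpoint_cons endpoint_nil => H.
  have [|o [r ->]] := @smooth_at1_inv p Dp'; last by exists (Some b, o), r.
  by case: b H => H; apply: H => // t; rewrite inE => /eqP->.
case: Hs => Es; [exact: (diag true)|exact: (diag false)|subst s].
case/smooth_at_cons=> [[]//|[Hp _]|/(smooth_at_gt0 _ _ Dp')//].
case: p Hp Dp' Dp en Hsm {diag} => // t p [->] /Delannoy_cons[_ Dp] _ en Hsm.
have [] := @smooth_at1_inv p Dp.
  have e2 : (endpoint [:: level; level]).1 = 4 by rewrite !endpoint_cons endpoint_nil.
  have -> : 1 = 5 - (endpoint [:: level; level]).1 by rewrite e2.
  apply: smooth_at_cat_inv.
  - by apply/Delannoy_cons; split=> //; apply/Delannoy_cons; split.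
  - by rewrite e2.
  (* The path has reached abscissa 4 and ends at [3n], so [n] is at least 2 and column 5 is
     designated. *)
  - apply: Hsm; apply: (@columnE n 1).
    have := vertex_x_ge0 _ (size p) Dp; rewrite -/(endpoint p).
    by move: en; rewrite !endpoint_cons /=; lia.
by move=> o [r ->]; exists (None, o), r.
Qed.

Lemma smooth_srcsP n p : Delannoy p -> (endpoint p).1 = (3 * n)%N%:Z ->
  {in columns n, forall c, smooth_at p c} -> exists bs, p = srcs bs.
Proof.
elim/ltn_ind: n p => n IH p Dp en Hsm.
have [n0|n_gt0] := posnP n.
  exists [::]; case: p Dp en {Hsm} => // s p /Delannoy_x_gt0.
  by move=> + en; rewrite en n0.
have [b [r def_p]] := smooth_src_prefix _ _ Dp en n_gt0 Hsm.
move: Dp en Hsm; rewrite def_p => /Delannoy_cat[Db Dr].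
rewrite endpoint_cat /= endpoint_src => en Hsm.
have := vertex_x_ge0 _ (size r) Dr; rewrite -/(endpoint r) => er_ge0.
have b_gt0 : (0 < width b)%N by case: b {def_p Db en Hsm} => [[b1|] b2].
have [|||bs ->] := IH (n - width b)%N _ r Dr.
- by lia.
- by lia.
(* Removing [b] shifts abscissas by [3 * width b], so column [i] of [r] is column [i + width b] of
   the whole path. *)
- move=> c; rewrite mem_columns => /existsP[[i /= lt_i] /eqP->].
  have -> : (3 * i + 2)%N%:Z = (3 * (i + width b) + 2)%N%:Z - (endpoint (src b)).1.
    by rewrite endpoint_src; lia.
  apply: smooth_at_cat_inv => //; first by rewrite endpoint_src; lia.
  by apply: Hsm; apply: columnE; lia.
by exists (b :: bs).
Qed.

(** * Vertically constrained paths as concatenations of block images *)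

Lemma vertically_constrained_cons s q : vertically_constrained (s :: q) <->
  [/\ s \in S_CW, ~ (s \in S_V /\ nth 0 q 0 \in S_V) & vertically_constrained q].
Proof.
split=> [[H1 H2]|[Hs Hv [H1 H2]]].
  split; first by apply: H1; rewrite mem_head.
    by case: q H2 {H1} => [|t q] H2; [case|apply: (H2 0%N)].
  split=> [t tq|k kq]; first by apply: H1; rewrite inE tq orbT.
  exact: (H2 k.+1).
split=> [t|[|k] kq]; first by rewrite inE => /predU1P[->|/H1].
  exact: Hv.
exact: H2.
Qed.

Lemma S_CW_E s : s \in S_CW = (s \in S_C) || (s \in S_V).
Proof. exact: mem_cat. Qed.

Lemma dir_in_S_C o : dir o \in S_C.
Proof. by case: o => [[]|]. Qed.

Lemma S_C_dir s : s \in S_C -> exists o, s = dir o.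
Proof. by move/S_C_E => [] ->; [exists (Some true)|exists (Some false)|exists None]. Qed.

Lemma S_V_dir s : s \in S_V -> exists b, s = merge_step (dir (Some b)).
Proof. by rewrite !inE => /orP[] /eqP->; [exists true|exists false]. Qed.

Lemma S_C_notin_S_V s : s \in S_C -> s \notin S_V.
Proof. by move/S_C_E => [] ->. Qed.

Lemma first_step_in_SC_tgts bs : first_step_in_SC (tgts bs).
Proof. by case: bs => // b bs _; apply: dir_in_S_C. Qed.

Lemma nth0_tgts bs : nth 0 (tgts bs) 0 \notin S_V.
Proof. by case: bs => // b bs; apply: S_C_notin_S_V; apply: dir_in_S_C. Qed.

Lemma vertically_constrained_tgts bs : vertically_constrained (tgts bs).
Proof.
elim: bs => [//|[o1 o2] bs IH]; rewrite tgts_cons.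
have o1V : dir o1 \notin S_V by apply: S_C_notin_S_V; apply: dir_in_S_C.
have o1CW : dir o1 \in S_CW by rewrite S_CW_E dir_in_S_C.
apply/vertically_constrained_cons; split=> //=; first by case=> /(negP o1V).
case: o2 => [b|] //=; apply/vertically_constrained_cons; split=> //.
  by case: b.
by case=> _ /(negP (nth0_tgts bs)).
Qed.

(** Each step of [S_C] opens a block, which absorbs the following step if that one is vertical. One
    or two steps are consumed at a time, hence the induction on the length. *)
Lemma vertically_constrainedP q :
  vertically_constrained q -> first_step_in_SC q -> exists bs, q = tgts bs.
Proof.
have [k] := ubnP (size q).
elim: k q => // k IH [_ _ _|s q lt_k]; first by exists [::].
move=> /vertically_constrained_cons[_ _ Hq] /(_ isT) /S_C_dir[o /= ->].
case: q lt_k Hq => [_ _|t q lt_k Hq]; first by exists [:: (o, None)].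
have /vertically_constrained_cons[+ Hv Hq'] := Hq.
rewrite S_CW_E => /orP[tC|tV].
  have [bs ->] := IH (t :: q) lt_k Hq (fun=> tC).
  by exists ((o, None) :: bs).
(* Two vertical steps are never consecutive, so what follows the vertical step [t] is empty or
   starts in [S_C] again. *)
have [|bs ->] := IH q (ltnW lt_k) Hq'.
  case: q Hv Hq' {lt_k Hq} => // u q Hv /vertically_constrained_cons[+ _ _] _.
  by rewrite S_CW_E => /orP[] // uV; case: Hv.
by have [b ->] := S_V_dir _ tV; exists ((o, Some b) :: bs).
Qed.

Lemma dir_inj : injective dir.
Proof. by move=> [[]|] [[]|]. Qed.

Lemma merge_dir_inj : injective (fun b => merge_step (dir (Some b))).
Proof. by move=> [] []. Qed.

(** Unique parsing: steps of [S_C] mark exactly the beginnings of blocks, and a vertical step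
    belongs to the block opened just before it. *)
Lemma tgts_inj : injective tgts.
Proof.
have VC b bs : tgts bs <> merge_step (dir (Some b)) :: behead (tgts bs).
  by move=> E; have := nth0_tgts bs; rewrite E; case: b {E}.
elim=> [|[o1 o2] bs IH] [|[o1' o2'] bs'] //; rewrite 2!tgts_cons.
move=> [/dir_inj <-]; case: o2 o2' => [b|] [b'|] /= E.
- by case: E => /merge_dir_inj <- /IH <-.
- by case: (VC b bs'); rewrite -E.
- by case: (VC b' bs); rewrite E.
- by rewrite (IH _ E).
Qed.

(** * Preservation of nonnegative heights *)

(** The variable starting height lets the condition split over concatenations, and the recursive
    form lets it compute on explicit blocks. *)
Fixpoint nonneg_from (y : int) (p : lattice_path) : bool :=
  (0 <= y) && (if p is s :: p1 then nonneg_from (y + s.2) p1 else true).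

Lemma nonneg_fromP y p :
  reflect (forall k, (k <= size p)%N -> 0 <= y + (vertex p k).2) (nonneg_from y p).
Proof.
elim: p y => [|s p IH] y /=.
  apply: (iffP idP) => [/andP[y0 _] [|//] _|/(_ 0%N isT)]; first by rewrite vertex0 addr0.
  by rewrite vertex0 addr0 andbT.
apply: (iffP andP) => [[y0 /IH H] [|k] k_le|H].
- by rewrite vertex0 addr0.
- by rewrite vertex_cons /= addrA; apply: H.
- split; first by have := H 0%N isT; rewrite vertex0 addr0.
  by apply/IH => k k_le; rewrite -addrA; have := H k.+1 k_le; rewrite vertex_cons.
Qed.

Lemma nonneg_heightsP p : nonneg_heights p <-> nonneg_from 0 p.
Proof.
split=> [H|/nonneg_fromP H k /H]; last by rewrite add0r.
by apply/nonneg_fromP => k /H; rewrite add0r.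
Qed.

Lemma nonneg_from_cat y p q : nonneg_from y (p ++ q) =
  nonneg_from y p && nonneg_from (y + (endpoint p).2) q.
Proof.
elim: p y => [|s p IH] y /=; last by rewrite IH endpoint_cons /= addrA andbA.
by rewrite endpoint_nil addr0; case: q => [|t q] /=; case: (0 <= y).
Qed.

(** A lost vertex is the midpoint of two equal diagonal steps, whose ends survive, or repeats the
    height of a surviving vertex next to a level step. *)
Lemma nonneg_from_src y b : nonneg_from y (src b) = nonneg_from y (tgt b).
Proof. by case: b => [[[]|] [[]|]] /=; lia. Qed.

Lemma nonneg_from_srcs y bs : nonneg_from y (srcs bs) = nonneg_from y (tgts bs).
Proof.
elim: bs y => [//|b bs IH] y; rewrite srcs_cons tgts_cons 2!nonneg_from_cat.
by rewrite nonneg_from_src endpoint_tgt IH.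
Qed.

(** * Both sets parametrised by sequences of blocks, and the bijections *)

Lemma smooth_DelannoyP n m p : smooth_Delannoy n m p <->
  exists bs, [/\ p = srcs bs, widths bs = n & (endpoint p).2 = m].
Proof.
split=> [[Dp ep Hsm]|[bs [-> <- <-]]].
  have [|bs def_p] := smooth_srcsP n _ Dp _ Hsm; first by rewrite ep.
  exists bs; split=> //; last by rewrite ep.
  by have := endpoint_srcs bs; rewrite -def_p ep /=; lia.
split; first exact: Delannoy_srcs.
  by rewrite -endpoint_srcs -surjective_pairing.
exact: smooth_srcs.
Qed.

Lemma smooth_SchroderE n m :
  smooth_Schroder n m = [set p | smooth_Delannoy n m p /\ nonneg_heights p].
Proof.
by apply/seteqP; split=> p [] => [[]|[]] ? ? ?; split.
Qed.

(** The height is read off [srcs bs] so that the conditions on [bs] are literally those of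
    [smooth_DelannoyP]. *)
Lemma CW_pathsP n m q : CW_paths n m q <->
  exists bs, [/\ q = tgts bs, widths bs = n & (endpoint (srcs bs)).2 = m].
Proof.
split=> [[Hq eq /(vertically_constrainedP _ Hq)[bs def_q]]|[bs [-> <- <-]]].
  exists bs; split=> //; move: eq; rewrite def_q endpoint_tgts => -[] //.
split; [exact: vertically_constrained_tgts| |exact: first_step_in_SC_tgts].
exact: endpoint_tgts.
Qed.

Theorem theorem22 (n : nat) (m : int) :
  set_bij (smooth_Schroder n m) (nonneg_CW_paths n m) (gamma (columns n)) /\
  set_bij (smooth_Delannoy n m) (CW_paths n m) (gamma (columns n)).
Proof.
have nonneg_srcs bs : nonneg_heights (srcs bs) <-> nonneg_heights (tgts bs).
  by rewrite !nonneg_heightsP nonneg_from_srcs.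
(* Equal images have the same block sequence by [tgts_inj], hence the same source; the Schröder case
   inherits this by restriction. *)
have inj : set_inj (smooth_Delannoy n m) (gamma (columns n)).
  move=> p p' /set_mem/smooth_DelannoyP[bs [-> w _]].
  move=> /set_mem/smooth_DelannoyP[bs' [-> w' _]].
  by rewrite !gamma_srcs // => /tgts_inj ->.
rewrite smooth_SchroderE; split; split.
- move=> p [/smooth_DelannoyP[bs [-> w h]] nn]; rewrite gamma_srcs //.
  by split; [apply/CW_pathsP; exists bs|apply/nonneg_srcs].
- by move=> p p' /set_mem[Dp _] /set_mem[Dp' _]; apply: inj; apply: mem_set.
- move=> q [/CW_pathsP[bs [-> w h]] nn]; exists (srcs bs); last exact: gamma_srcs.
  by split; [apply/smooth_DelannoyP; exists bs|apply/nonneg_srcs].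
- move=> p /smooth_DelannoyP[bs [-> w h]]; rewrite gamma_srcs //.
  by apply/CW_pathsP; exists bs.
- exact: inj.
- move=> q /CW_pathsP[bs [-> w h]]; exists (srcs bs); last exact: gamma_srcs.
  by apply/smooth_DelannoyP; exists bs.
Qed.
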